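(* The algorithm kl-UCB-CF using $f(t)=\log(t)+3\log(\log(t))$ on a $K$-armed Bernoulli corrupt bandit with strictly monotonic and continuous corruption functions $\{g_a\}_{a\in A}$, $A=\{1,\dots,K\}$, in which arm $1$ is the optimal arm, satisfies at time $T$, $$\mathrm{Regret}_T \;\leq\; \sum_{a = 2}^{K}\frac{\Delta_a \log (T) }{d\left(\lambda_a,g_a(\mu_1)\right)} + O\big(\sqrt{\log(T)}\big).$$
   Context: **Bernoulli corrupt bandit.** There is a set of arms $A=\{1,\dots,K\}$. Each arm $a$ has an unknown Bernoulli reward distribution with mean $\mu_a\in[0,1]$, an unknown Bernoulli feedback distribution with mean $\lambda_a\in[0,1]$, and a known corruption function $g_a$, continuous at least on $[0,1]$, such that $g_a(\mu_a)=\lambda_a$. The functions $g_a$ may differ from one arm to another, and each may be increasing or decreasing. If the learner pulls arm $a$ at time $t$, they receive a reward $R_t$ drawn from the reward distribution of $a$ (not observed) and observe a feedback $F_t$ drawn from the feedback distribution of $a$. The arm $\hat a_t$ pulled at time $t$ is chosen based only on the previously observed feedback $F_1,\dots,F_{t-1}$. **Regret.** Arm $1$ is the optimal arm, i.e. the arm of maximal mean reward $\mu_a$ (without loss of generality). Put $\Delta_a=\mu_1-\mu_a$ and $N_a(t)=\sum_{s=1}^{t}\mathbf 1_{(\hat a_s=a)}$. Then $\mathrm{Regret}_T=\mathbb E[\mu_1T-\sum_{t=1}^TR_t]=\sum_{a=2}^K\Delta_a\,\mathbb E[N_a(T)]$. **Divergence.** $d(x,y)=x\log(x/y)+(1-x)\log((1-x)/(1-y))$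 is the Kullback–Leibler divergence between the Bernoulli distributions of means $x$ and $y$. **Algorithm kl-UCB-CF.** Its parameters are a non-decreasing exploration function $f$ and the time horizon $T$. First pull each arm once. Then for $t=K,\dots,T-1$: compute for each arm $a$ $$\mathrm{Index}_a(t)=\max\{q:\ N_a(t)\,d(\hat\lambda_a(t),g_a(q))\le f(t)\},\qquad \hat\lambda_a(t)=\frac1{N_a(t)}\sum_{s=1}^tF_s\mathbf 1_{(\hat a_s=a)},$$ pull arm $\hat a_{t+1}=\arg\max_a\mathrm{Index}_a(t)$ and observe the feedback $F_{t+1}$. The formula for $f(t)$ is used for $t\ge3$. *)

(* Defs.v *)
From mathcomp Require Export all_boot all_order all_algebra.
From mathcomp Require Export all_classical all_reals all_analysis.
Export Order.TTheory GRing.Theory Num.Theory.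
Export numFieldNormedType.Exports.
Set Implicit Arguments.
Unset Strict Implicit.
Unset Printing Implicit Defensive.

Local Open Scope classical_set_scope.
Local Open Scope ring_scope.

(* Bernoulli KL divergence, for x in [0, 1]. Usual conventions: 0 log 0 = 0,
   and the value is +oo when Ber(x) is not absolutely continuous with respect
   to Ber(y), or when y is not the mean of a Bernoulli distribution. In the
   first branch a summand whose logarithm is degenerate (e.g. ln 0, which is 0
   here) has coefficient 0. *)
Definition kl (R : realType) (x y : R) : \bar R :=
  if [&& 0 <= y <= 1, (y == 0) ==> (x == 0) & (y == 1) ==> (x == 1)]
  then (x * ln (x / y) + (1 - x) * ln ((1 - x) / (1 - y)))%:E
  else +oo%E.

(* The arms are the K = k.+1 elements of 'I_k.+1; ord0 stands for arm 1. *)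
Definition corrupt_bandit (R : realType) (k : nat)
    (mu lambda : 'I_k.+1 -> R) (g : 'I_k.+1 -> R -> R) : Prop :=
  forall a, [/\ 0 <= mu a <= 1, 0 <= lambda a <= 1,
    {within `[0, 1], continuous (g a)} & g a (mu a) = lambda a].

Definition strictly_monotone01 (R : realType) (g : R -> R) : Prop :=
  {in `[0, 1] &, forall x y, x < y -> g x < g y} \/
  {in `[0, 1] &, forall x y, x < y -> g y < g x}.

Definition optimal_arm (R : realType) (k : nat) (mu : 'I_k.+1 -> R)
    (a : 'I_k.+1) : Prop := forall b, mu b <= mu a.

Section Policy.
Context {R : realType} {k : nat}.

(* A policy maps the list h = [:: F_1; ...; F_t] of observed feedbacks to the
   arm pulled at time t + 1; so the arm pulled at time s + 1 along h is
   pi (take s h). *)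
Definition policy : Type := seq bool -> 'I_k.+1.

Implicit Types (pi : policy) (h : seq bool) (a : 'I_k.+1).

Definition npulls pi h a : nat :=
  \sum_(s < size h) (pi (take s h) == a).

Definition mean_feedback pi h a : R :=
  (\sum_(s < size h | pi (take s h) == a) (nth false h s)%:R)
  / (npulls pi h a)%:R.

(* q ranges over the possible mean rewards. *)
Definition index_set (g : 'I_k.+1 -> R -> R) (f : nat -> R) pi h a : set R :=
  [set q | 0 <= q <= 1 /\
    ((npulls pi h a)%:R%:E * kl (mean_feedback pi h a) (g a q)
       <= (f (size h))%:E)%E].

(* q is the maximum of S, or S is empty. The index set is empty when the
   empirical mean is too far from the range of g a; no particular value is
   then imposed on the index. *)
Definition is_max_or_empty (S : set R) (q : R) : Prop :=
  S !=set0 -> S q /\ ubound S q.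

(* The order of the K initial pulls and the choice among maximisers are left
   arbitrary. *)
Definition kl_ucb_cf (g : 'I_k.+1 -> R -> R) (f : nat -> R) (T : nat) pi
    : Prop :=
  (forall h, size h = k.+1 -> forall a, npulls pi h a = 1%N) /\
  (forall h, (k.+1 <= size h < T)%N ->
    exists index : 'I_k.+1 -> R,
      (forall a, is_max_or_empty (index_set g f pi h a) (index a)) /\
      (forall a, index a <= index (pi h))).

End Policy.
Arguments policy : clear implicits.

Section Interaction.
Context {R : realType} {k : nat} {d : measure_display} {Om : measurableType d}.
Variable P : probability Om R.

Definition history (X : nat -> {RV P >-> bool}) (t : nat) (w : Om) : seq bool :=
  mkseq (fun s => X s w) t.

(* Fb s and Rw s are the feedback and the reward of time s + 1. Given all past
   feedbacks and rewards, each follows the Bernoulli distribution of the pulled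
   arm; their joint conditional law is unconstrained. *)
Definition bandit_run (mu lambda : 'I_k.+1 -> R) (pi : policy k) (T : nat)
    (Fb Rw : nat -> {RV P >-> bool}) : Prop :=
  forall (t : nat) (h r : seq bool) (U : set bool), (t < T)%N ->
    let past := [set w | history Fb t w = h /\ history Rw t w = r] in
    P (past `&` Fb t @^-1` U) = (P past * bernoulli_prob (lambda (pi h)) U)%E /\
    P (past `&` Rw t @^-1` U) = (P past * bernoulli_prob (mu (pi h)) U)%E.

Definition regret (mu : 'I_k.+1 -> R) (T : nat)
    (Rw : nat -> {RV P >-> bool}) : \bar R :=
  'E_P[fun w => mu ord0 * T%:R - \sum_(t < T) (Rw t w)%:R].

End Interaction.

(* Main.v *)
Require Import Defs.
From mathcomp Require Import zify ring lra.
Local Open Scope classical_set_scope.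
Local Open Scope ring_scope.
Set Implicit Arguments.
Unset Strict Implicit.
Unset Printing Implicit Defensive.

(* A pull of a suboptimal arm a at time t + 1 has one of two causes. Either the
   true mean of arm 1 or of a falls outside its confidence region, that is,
   N d(mean feedback, lambda) > f(t) for one of the two arms; or the index of a
   is a genuine maximum, at least mu_1, and then
   N_a d(mean feedback of a, g_a(q)) <= f(T) for some q >= mu_1, which by
   convexity of d forces the feedbacks of a to exceed their expectation by
   c (N_a - n0), where n0 = f(T) / d(lambda_a, g_a(mu_1)).

   The first event has probability O(1 / (t log t)): the values of N are cut
   into O(f(t) log t) slices on which log N varies by at most 1 / f(t), and on
   each slice a single likelihood-ratio martingale is at least e^(f(t) - 1) on
   the event. The second one occurs at most n0 + 1 times with N_a < n0, and
   O(sqrt(log T)) times in expectation with N_a >= n0, by an exponential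
   supermartingale with parameter of order 1 / sqrt(log T).

   Only the law of the feedback sequence matters; it is described as a
   probability tree on boolean lists. *)

(** * Bernoulli divergence *)

Section Divergence.
Context {R : realType}.
Implicit Types x y z l : R.

(** [expR x] is at most [1 / (1 - x)], and [(1 + x + 2 x^2) (1 - x) = 1 + x^2 (1 - 2 x)] is at least
    1. *)
Lemma expR_le_quad x : x <= 2^-1 -> expR x <= 1 + x + 2 * x ^+ 2.
Proof.
move=> hx; have h := expR_ge1Dx (- x).
have e0 := expR_gt0 x; have hv : expR x * expR (- x) = 1 by rewrite expRN divff ?gt_eqF.
rewrite -(@ler_pM2r _ (1 - x)) ?subr_gt0; last by lra.
apply: (@le_trans _ _ 1); last by rewrite -subr_ge0; nra.
by rewrite -[leRHS]hv ler_pM2l.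
Qed.

(** The linear terms of the quadratic bounds cancel, leaving [1 + 2 l (1 - l) s^2], which is at most
    [1 + s^2]. *)
Lemma bernoulli_mgf_le l (s : R) : 0 <= l <= 1 -> `|s| <= 2^-1 ->
  l * expR (s * (1 - l)) + (1 - l) * expR (- (s * l)) <= expR (s ^+ 2).
Proof.
move=> /andP[l0 l1] hs; have := hs; rewrite ler_norml => /andP[s0 s1].
apply: (@le_trans _ _ (1 + s ^+ 2)); last exact: expR_ge1Dx.
have h1 : s * (1 - l) <= 2^-1 by nra.
have h2 : - (s * l) <= 2^-1 by nra.
have := ler_wpM2l l0 (expR_le_quad h1).
have l1' : 0 <= 1 - l by lra.
have := ler_wpM2l l1' (expR_le_quad h2).
have hl : 0 <= (1 - 2 * l) ^+ 2 by exact: sqr_ge0.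
have hss : 0 <= s ^+ 2 by exact: sqr_ge0.
have : 0 <= s ^+ 2 * (1 - 2 * l) ^+ 2 by exact: mulr_ge0.
nra.
Qed.

Definition klr x y : R := x * ln (x / y) + (1 - x) * ln ((1 - x) / (1 - y)).

(** Difference of the log-odds of [z] and [y]; it is the slope in [x] of [klr x y - klr x z]. *)
Definition logit_diff z y : R := ln (z / y) - ln ((1 - z) / (1 - y)).

Lemma mul_ln_chain x y z : 0 <= x -> 0 < y -> 0 < z ->
  x * ln (x / y) = x * ln (x / z) + x * ln (z / y).
Proof.
rewrite le_eqVlt => /predU1P[<- _ _|x0 y0 z0]; first by rewrite !mul0r addr0.
by rewrite !ln_div ?posrE//; ring.
Qed.

(** Three-point identity of a Bregman divergence. It stands in for calculus: strict positivity,
    monotonicity and the tangent bound for [klr] are read off from the sign of the last term. *)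
Lemma klr_three_point x y z : 0 <= x <= 1 -> 0 < y < 1 -> 0 < z < 1 ->
  klr x y = klr x z + klr z y + (x - z) * logit_diff z y.
Proof.
move=> /andP[x0 x1] /andP[y0 y1] /andP[z0 z1].
rewrite /klr /logit_diff (mul_ln_chain x0 y0 z0).
rewrite (@mul_ln_chain (1 - x) (1 - y) (1 - z)) ?subr_ge0 ?subr_gt0//.
ring.
Qed.

Lemma klrN x y : klr (1 - x) (1 - y) = klr x y.
Proof. by rewrite /klr !subKr addrC. Qed.

Lemma klr_refl x : 0 <= x <= 1 -> klr x x = 0.
Proof.
move=> /andP[x0 x1]; rewrite /klr.
have h z : 0 <= z -> z * ln (z / z) = 0.
  rewrite le_eqVlt => /predU1P[<-|z0]; first by rewrite mul0r.
  by rewrite divff ?gt_eqF// ln1 mulr0.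
by rewrite !h ?addr0// subr_ge0.
Qed.

Lemma mul_ln_ge x y : 0 <= x -> 0 < y -> x - y <= x * ln (x / y).
Proof.
rewrite le_eqVlt => /predU1P[<- y0|x0 y0]; first by rewrite mul0r sub0r oppr_le0 ltW.
have : ln (y / x) <= y / x - 1.
  by rewrite -[X in ln X](addrNK 1) addrC le_ln1Dx// ltrBrDl subrr divr_gt0.
rewrite !ln_div ?posrE// => h.
have := ler_wpM2l (ltW x0) h.
by rewrite mulrBr mulrBr mulr1 mulrCA divff ?gt_eqF// mulr1 mulrBr; lra.
Qed.

Lemma klr_ge0 x y : 0 <= x <= 1 -> 0 < y < 1 -> 0 <= klr x y.
Proof.
move=> /andP[x0 x1] /andP[y0 y1]; rewrite /klr.
have := mul_ln_ge x0 y0.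
have := @mul_ln_ge (1 - x) (1 - y); rewrite subr_ge0 subr_gt0 => /(_ x1 y1); lra.
Qed.

Lemma logit_diff_gt0 z y : 0 < y -> y < z -> z < 1 -> 0 < logit_diff z y.
Proof.
move=> y0 yz z1; have z0 := lt_trans y0 yz; have y1 := lt_trans yz z1.
rewrite /logit_diff !ln_div ?posrE ?subr_gt0//.
have : ln y < ln z by rewrite ltr_ln ?posrE.
have : ln (1 - z) < ln (1 - y) by rewrite ltr_ln ?posrE; lra.
lra.
Qed.

Lemma logit_diff_lt0 z y : 0 < z -> z < y -> y < 1 -> logit_diff z y < 0.
Proof.
move=> z0 zy y1; have y0 := lt_trans z0 zy; have z1 := lt_trans zy y1.
rewrite /logit_diff !ln_div ?posrE ?subr_gt0//.
have : ln z < ln y by rewrite ltr_ln ?posrE.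
have : ln (1 - y) < ln (1 - z) by rewrite ltr_ln ?posrE; lra.
lra.
Qed.

Lemma klr_gt0 x y : 0 <= x -> x < y -> y < 1 -> 0 < klr x y.
Proof.
move=> x0 xy y1.
have hz : x < 2^-1 * (x + y) < y by apply/andP; split; lra.
set z := 2^-1 * _ in hz; have /andP[xz zy] := hz.
rewrite (@klr_three_point x y z); last 3 first.
- by apply/andP; split; lra.
- by apply/andP; split; lra.
- by apply/andP; split; lra.
have z0 : 0 < z by lra.
have := logit_diff_lt0 z0 zy y1.
have := @klr_ge0 x z; have := @klr_ge0 z y.
move=> /(_ ltac:(apply/andP; split; lra) ltac:(apply/andP; split; lra)) a.
move=> /(_ ltac:(apply/andP; split; lra) ltac:(apply/andP; split; lra)) b.
nra.
Qed.

Lemma klr_le x y z : 0 <= x -> x <= z -> 0 < z -> z <= y -> y < 1 ->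
  klr x z <= klr x y.
Proof.
move=> x0 xz z0; rewrite le_eqVlt => /predU1P[->//|zy] y1.
rewrite (@klr_three_point x y z); last 3 first.
- by apply/andP; split; lra.
- by apply/andP; split; lra.
- by apply/andP; split; lra.
have := logit_diff_lt0 z0 zy y1.
have := @klr_ge0 z y; move=> /(_ ltac:(apply/andP; split; lra) ltac:(apply/andP; split; lra)) a.
nra.
Qed.

Lemma klE x y : [&& 0 <= y <= 1, (y == 0) ==> (x == 0) & (y == 1) ==> (x == 1)] ->
  kl x y = (klr x y)%:E.
Proof. by rewrite /kl /klr => ->. Qed.

Lemma klN x y : kl (1 - x) (1 - y) = kl x y.
Proof.
rewrite /kl -/(klr (1 - x) (1 - y)) klrN -/(klr x y).
have -> : (0 <= 1 - y <= 1) = (0 <= y <= 1).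
  by rewrite subr_ge0 lerBlDr lerDl andbC.
have h (u : R) : (1 - u == 0) = (u == 1) by rewrite subr_eq0 eq_sym.
have h' (u : R) : (1 - u == 1) = (u == 0).
  by rewrite -subr_eq0 addrAC subrr sub0r oppr_eq0.
by rewrite !h !h' andbA (andbAC _ (_ ==> _)) -andbA.
Qed.

Lemma kl_refl x : 0 <= x <= 1 -> kl x x = 0%E.
Proof. by move=> x01; rewrite klE ?klr_refl// x01 !implybb. Qed.

Lemma kl_lty x y : (kl x y < +oo)%E ->
  [/\ 0 <= y <= 1, y = 0 -> x = 0, y = 1 -> x = 1 & kl x y = (klr x y)%:E].
Proof.
rewrite /kl -/(klr x y); case: ifP => [/and3P[-> h0 h1] _|_]; last by rewrite ltxx.
by split => // /eqP; [move/(implyP h0)/eqP | move/(implyP h1)/eqP].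
Qed.

(** Positivity of [n] matters: since [0 * +oo = 0], the bound could otherwise hold with an infinite
    divergence. *)
Lemma mul_kl_fin (n F : R) x y : 0 < n -> (n%:E * kl x y <= F%:E)%E ->
  [/\ 0 <= y <= 1, y = 0 -> x = 0, y = 1 -> x = 1 & n * klr x y <= F].
Proof.
move=> n0 h.
have hfin : (kl x y < +oo)%E.
  have : kl x y != +oo%E.
    by apply: contraTneq h => ->; rewrite gt0_muley ?lte_fin// -ltNge ltey.
  by rewrite ltey.
have [a b c e] := kl_lty hfin; split => //.
by move: h; rewrite e -EFinM lee_fin.
Qed.

(* This is 0 when [kl l y = +oo], but also, because of [fine], when [kl l y = 0]. *)
Definition inv_kl l y : R := fine (kl l y)^-1%E.

Lemma inv_klE l y : 0 <= l -> l < y -> 0 < y < 1 -> inv_kl l y = (klr l y)^-1.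
Proof.
move=> l0 ly /andP[y0 y1]; rewrite /inv_kl klE ?fine_invr//.
by rewrite (gt_eqF y0) (lt_eqF y1) !ltW.
Qed.

Lemma inv_klN l y : inv_kl (1 - l) (1 - y) = inv_kl l y.
Proof. by rewrite /inv_kl klN. Qed.

(* [l = 0] and [l = 1] have to be singled out because [klr _ y] has infinite
   slope there; the empirical mean then equals [l] almost surely. *)
Lemma kl_le_deviation_above l y1 : 0 <= l <= 1 -> l < y1 ->
  exists2 c : R, 0 < c <= 1 & forall (n x y F : R), 0 <= n -> 0 <= x <= 1 ->
    (l = 0 -> x = 0) -> (l = 1 -> x = 1) -> y1 <= y ->
    (n%:E * kl x y <= F%:E)%E -> inv_kl l y1 * F <= n ->
    c * (n - inv_kl l y1 * F) <= n * (x - l).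
Proof.
move=> /andP[l0 l1] ly.
have [y1ge|y1lt] := leP 1 y1.
  (* A positive [n] forces [y = y1 = 1], hence [x = 1]; since [kl l 1 = +oo], the threshold is then
     0. *)
  exists (Num.min 1 (y1 - l)); first by rewrite lt_min ltr01 subr_gt0 ly ge_min lexx.
  move=> n x y F; rewrite le_eqVlt => /predU1P[<-|n0] x01 lx0 lx1 yy h.
    rewrite !mul0r sub0r => h1; rewrite mulrN oppr_le0 mulr_ge0//.
      by rewrite le_min ler01 subr_ge0 ltW.
    have [z|z] := leP 0 F; last first.
      by move: h; rewrite mul0e lee_fin leNgt z.
    apply: mulr_ge0 => //; rewrite /inv_kl fine_ge0// inve_ge0.
    rewrite /kl; case: ifP => // /and3P[a _ /implyP b]; rewrite lee_fin.
    have y11 : y1 = 1 by apply/eqP; rewrite eq_le y1ge; case/andP: a => _ ->.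
    move: (b (introT eqP y11)) => /eqP l1'; move: ly; rewrite l1' y11 ltxx//.
  have [/andP[_ y1'] _ hx _] := mul_kl_fin n0 h.
  have yE : y = 1 by apply/le_anti; rewrite y1' (le_trans y1ge).
  have y1E : y1 = 1 by apply/le_anti; rewrite y1ge -[leRHS]yE yy.
  rewrite (hx yE) /inv_kl y1E /kl lexx ler01 oner_eq0 eqxx /=.
  have -> : l == 1 = false by rewrite -y1E lt_eqF.
  rewrite invey /= mul0r subr0 => _; rewrite mulrC ler_wpM2l ?(ltW n0)//.
  by rewrite ge_min lexx orbT.
have y0 : 0 < y1 by lra.
have ll1 : l < 1 by lra.
rewrite inv_klE ?y0// ; set r := klr l y1.
have r0 : 0 < r by apply: klr_gt0.
(* Tangent of [klr _ y1] at [l], from the three-point identity. For [l = 0] only [x = 0] occurs and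
   any positive [L] will do. *)
have [L L0 HL] : exists2 L : R, 0 < L & forall x, 0 <= x <= 1 ->
    (l = 0 -> x = 0) -> r - L * (x - l) <= klr x y1.
  move: l0; rewrite le_eqVlt => /predU1P[l0|l0].
    exists 1 => // x x01 /(_ (esym l0)) ->.
    by rewrite -l0 subr0 mulr0 subr0 /r -l0.
  exists (- logit_diff l y1); first by rewrite oppr_gt0 logit_diff_lt0.
  move=> x x01 _; rewrite (@klr_three_point x y1 l) ?l0 ?y0//.
  have : 0 <= klr x l by apply: klr_ge0; rewrite ?l0.
  by rewrite /r; lra.
(* [r / L] serves when [x < y1], through the tangent bound; [y1 - l] serves when [x >= y1], where
   [x - l >= y1 - l] and [F >= 0]. *)
exists (Num.min (r / L) (y1 - l)).
  rewrite lt_min divr_gt0//= subr_gt0 ly ge_min; apply/orP; right; lra.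
move=> n x y F n0 x01 lx0 lx1 yy h hn.
have d0 : 0 <= n - r^-1 * F by rewrite subr_ge0.
have F0 : 0 <= F -> n - r^-1 * F <= n.
  by move=> F0; rewrite gerBl mulr_ge0// invr_ge0 ltW.
have FF : 0 <= n * klr x y -> n * klr x y <= F -> 0 <= F by exact: le_trans.
move: n0; rewrite le_eqVlt => /predU1P[n0|n0].
  move: h; rewrite -n0 mul0e lee_fin => /F0; rewrite -n0 => h; rewrite mul0r.
  apply: mulr_ge0_le0 => //.
  by rewrite le_min divr_ge0 ?(ltW r0) ?(ltW L0)//= subr_ge0 ltW.
have [/andP[_ y1'] _ hx hk] := mul_kl_fin n0 h.
have := HL _ x01 lx0; move: (x01) => /andP[x0 x1].
have [xy|xy] := ltP x y1; last first.
  move=> _.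
  have kF : 0 <= F.
    move: y1'; rewrite le_eqVlt => /predU1P[y1'|y1'].
      by move: hk; rewrite (hx y1') y1' klr_refl ?mulr0// ler01 lexx.
    by apply: FF hk; rewrite mulr_ge0 ?(ltW n0)// klr_ge0//; apply/andP; split; lra.
  apply: (@le_trans _ _ ((y1 - l) * n)).
    by apply: ler_pM => //; rewrite ?F0// ?ge_min ?lexx ?orbT// le_min
      divr_ge0 ?(ltW r0) ?(ltW L0)//= subr_ge0 ltW.
  by rewrite mulrC ler_wpM2l ?(ltW n0)// lerB.
have ylt1 : y < 1.
  by rewrite lt_neqAle y1' andbT; apply: contraTneq xy => /hx ->; rewrite -leNgt ltW.
have hle : klr x y1 <= klr x y by apply: klr_le => //; exact: ltW.
move=> hL; apply: (@le_trans _ _ (r / L * (n - r^-1 * F))).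
  by rewrite ler_wpM2r// ge_min lexx.
rewrite mulrAC ler_pdivrMr// mulrBr mulVKf ?gt_eqF//.
have := ler_wpM2l (ltW n0) (le_trans hL hle); lra.
Qed.

(** Exchanging the two outcomes turns the case [y1 < l] into the previous lemma; the sign lets one
    statement cover both sides. *)
Lemma kl_le_deviation l y1 : 0 <= l <= 1 -> l != y1 ->
  exists2 c : R, 0 < c <= 1 & forall (n x y F : R), 0 <= n -> 0 <= x <= 1 ->
    (l = 0 -> x = 0) -> (l = 1 -> x = 1) -> 0 <= Num.sg (y1 - l) * (y - y1) ->
    (n%:E * kl x y <= F%:E)%E -> inv_kl l y1 * F <= n ->
    c * (n - inv_kl l y1 * F) <= Num.sg (y1 - l) * (n * (x - l)).
Proof.
move=> l01; rewrite neq_lt => /orP[ly|ly].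
  have [c c01 H] := kl_le_deviation_above l01 ly.
  exists c => // n x y F n0 x01 x0 x1; rewrite gtr0_sg ?subr_gt0// !mul1r.
  by rewrite subr_ge0; exact: H.
have := @kl_le_deviation_above (1 - l) (1 - y1).
move=> /(_ ltac:(case/andP: l01 => ? ?; apply/andP; split; lra) ltac:(lra)) [c c01 H].
exists c => // n x y F n0 x01 x0 x1; rewrite ltr0_sg ?subr_lt0// !mulN1r.
move=> yy h hn; have := H n (1 - x) (1 - y) F n0.
rewrite klN inv_klN; have -> : 1 - x - (1 - l) = - (x - l) by ring.
rewrite mulrN; apply => //.
- by case/andP: x01 => ? ?; apply/andP; split; lra.
- by move=> e; rewrite x1 ?subrr//; lra.
- by move=> e; rewrite x0 ?subr0//; lra.
- by lra.
Qed.

End Divergence.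

(** * Expectations along the feedback tree *)

Section FeedbackTree.
Context {R : realType}.
Variable p : seq bool -> R.
Hypothesis p01 : forall h, 0 <= p h <= 1.
Implicit Types (F G V c : seq bool -> R) (h : seq bool).

(* [p h] stands for the conditional probability that the next feedback is 1 after
   the feedbacks [h]; [tree_mean t F] is then the expectation of F(F_1, ..., F_t). *)
Definition next_mean F h : R := p h * F (rcons h true) + (1 - p h) * F (rcons h false).

Fixpoint tree_mean t F : R := if t is s.+1 then tree_mean s (next_mean F) else F [::].

(** Lists of positive probability. On them an arm with [lambda] equal to 0 or 1 has its empirical
    mean equal to [lambda] once pulled, which settles the degenerate divergences. *)
Inductive reachable : seq bool -> Prop :=
| reachable_nil : reachable [::]
| reachable_true h : reachable h -> 0 < p h -> reachable (rcons h true)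
| reachable_false h : reachable h -> p h < 1 -> reachable (rcons h false).

Lemma next_mean_le F G h :
  (0 < p h -> F (rcons h true) <= G (rcons h true)) ->
  (p h < 1 -> F (rcons h false) <= G (rcons h false)) ->
  next_mean F h <= next_mean G h.
Proof.
have /andP[] := p01 h; rewrite /next_mean => p0 p1 ht hf; apply: lerD.
  move: p0; rewrite le_eqVlt => /predU1P[<-|p0]; first by rewrite !mul0r.
  by rewrite ler_pM2l// ht.
move: p1; rewrite le_eqVlt => /predU1P[->|p1]; first by rewrite subrr !mul0r.
by rewrite ler_pM2l ?subr_gt0// hf.
Qed.

Lemma tree_mean_le t F G :
  (forall h, size h = t -> reachable h -> F h <= G h) ->
  tree_mean t F <= tree_mean t G.
Proof.
elim: t F G => [|t IH] F G FG /=; first by apply: FG => //; exact: reachable_nil.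
apply: IH => h sh rh; apply: next_mean_le => ph; apply: FG; rewrite ?size_rcons ?sh//.
- exact: reachable_true.
- exact: reachable_false.
Qed.

Lemma tree_meanD t F G :
  tree_mean t (fun h => F h + G h) = tree_mean t F + tree_mean t G.
Proof.
elim: t F G => [|t IH] F G //=; rewrite -IH; congr tree_mean.
by apply/funext => h; rewrite /next_mean; ring.
Qed.

Lemma tree_meanZ t (r : R) F : tree_mean t (fun h => r * F h) = r * tree_mean t F.
Proof.
elim: t F => [|t IH] F //=; rewrite -IH; congr tree_mean.
by apply/funext => h; rewrite /next_mean; ring.
Qed.

Lemma tree_mean_cst t (r : R) : tree_mean t (fun=> r) = r.
Proof.
elim: t => [|t IH] //=; rewrite -[RHS]IH; congr tree_mean.
by apply/funext => h; rewrite /next_mean; ring.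
Qed.

Lemma tree_mean_sum (I : finType) (P : pred I) t (F : I -> seq bool -> R) :
  tree_mean t (fun h => \sum_(i | P i) F i h) = \sum_(i | P i) tree_mean t (F i).
Proof.
elim: (index_enum I) => [|i s IH].
  rewrite big_nil -[RHS](@tree_mean_cst t); congr tree_mean.
  by apply/funext => h; rewrite big_nil.
rewrite big_cons -IH; case: (boolP (P i)) => Pi; rewrite -?tree_meanD;
  by congr tree_mean; apply/funext => h; rewrite big_cons ?Pi ?(negbTE Pi).
Qed.

Lemma tree_mean_martingale t F : (forall h, next_mean F h = F h) -> tree_mean t F = F [::].
Proof. by move=> /funext hF; elim: t => //= t; rewrite hF. Qed.

(** The decrease of the mean of [V] at each step pays for the mean of [c]; the sum telescopes, and
    the final mean of [V] is dropped since it is nonnegative. *)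
Lemma tree_mean_potential (T : nat) V c :
  (forall h, reachable h -> 0 <= V h) ->
  (forall h, (size h < T)%N -> reachable h -> next_mean V h + c h <= V h) ->
  \sum_(t < T) tree_mean t c <= V [::].
Proof.
move=> V0 Vc.
suff h n : (n <= T)%N -> \sum_(t < n) tree_mean t c + tree_mean n V <= V [::].
  apply: le_trans (h T (leqnn _)); rewrite lerDl -(@tree_mean_cst T 0).
  by apply: tree_mean_le => s _; exact: V0.
elim: n => [|n IH] nT; first by rewrite big_ord0 add0r.
apply: le_trans (IH (ltnW nT)); rewrite big_ord_recr /= -addrA lerD2l.
rewrite -tree_meanD; apply: tree_mean_le => h sh rh.
by rewrite addrC; apply: Vc; rewrite ?sh.
Qed.

End FeedbackTree.

(** * Pull and success counts, and potential bounds on pulls *)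

Section Counts.
Context {R : realType} {k : nat}.
Variable pi : policy k.
Implicit Types (h : seq bool) (a : 'I_k.+1).

Definition nsucc h a : nat := \sum_(s < size h | pi (take s h) == a) nth false h s.

Lemma npulls_nil a : npulls pi [::] a = 0%N.
Proof. by rewrite /npulls big_ord0. Qed.

Lemma nsucc_nil a : nsucc [::] a = 0%N.
Proof. by rewrite /nsucc big_ord0. Qed.

Lemma npulls_rcons h b a : npulls pi (rcons h b) a = (npulls pi h a + (pi h == a))%N.
Proof.
rewrite /npulls size_rcons big_ord_recr /= -cats1 take_size_cat//; congr addn.
by apply: eq_bigr => s _; rewrite takel_cat// ltnW.
Qed.

Lemma nsucc_rcons h b a : nsucc (rcons h b) a = (nsucc h a + (pi h == a) * b)%N.
Proof.
rewrite /nsucc size_rcons big_mkcond big_ord_recr /= -cats1 take_size_cat//.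
congr addn; last by rewrite nth_cat ltnn subnn; case: (_ == _); rewrite ?mul1n ?mul0n.
rewrite [RHS]big_mkcond; apply: eq_bigr => s _.
by rewrite takel_cat ?(ltnW (ltn_ord _))// nth_cat ltn_ord.
Qed.

Lemma nsucc_le_npulls h a : (nsucc h a <= npulls pi h a)%N.
Proof.
elim/last_ind: h => [|h b IH]; first by rewrite nsucc_nil.
rewrite nsucc_rcons npulls_rcons leq_add// -[leqRHS]muln1 leq_mul//.
by case: b.
Qed.

Lemma npulls_le_size h a : (npulls pi h a <= size h)%N.
Proof.
elim/last_ind: h => [|h b IH]; first by rewrite npulls_nil.
by rewrite npulls_rcons size_rcons -[leqRHS]addn1 leq_add// leq_b1.
Qed.

Lemma mean_feedbackE h a :
  mean_feedback pi h a = (nsucc h a)%:R / (npulls pi h a)%:R :> R.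
Proof. by rewrite /mean_feedback; congr (_ / _); rewrite /nsucc natr_sum. Qed.

Lemma mean_feedback_itv h a : 0 <= mean_feedback (R := R) pi h a <= 1.
Proof.
rewrite mean_feedbackE divr_ge0//=.
have [->|n0] := posnP (npulls pi h a); first by rewrite invr0 mulr0 ler01.
by rewrite ler_pdivrMr ?ltr0n// mul1r ler_nat nsucc_le_npulls.
Qed.

Lemma npulls_mean_feedback h a :
  (npulls pi h a)%:R * mean_feedback pi h a = (nsucc h a)%:R :> R.
Proof.
rewrite mean_feedbackE; have := nsucc_le_npulls h a.
have [->|n0 _] := posnP (npulls pi h a).
  by rewrite leqn0 => /eqP ->; rewrite !mul0r.
by rewrite mulrC divfK// pnatr_eq0 -lt0n.
Qed.

Variable lambda : 'I_k.+1 -> R.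
Hypothesis lambda01 : forall a, 0 <= lambda a <= 1.
Let p h := lambda (pi h).

Let p01 h : 0 <= p h <= 1. Proof. exact: lambda01. Qed.

Lemma nsucc_reachable0 h a : reachable p h -> lambda a = 0 -> nsucc h a = 0%N.
Proof.
elim=> [|{}h _ IH hp la|{}h _ IH hp la]; rewrite ?nsucc_nil// nsucc_rcons IH//.
  by case: eqP => // e; move: hp; rewrite /p e la ltxx.
by rewrite muln0.
Qed.

Lemma nsucc_reachable1 h a : reachable p h -> lambda a = 1 ->
  nsucc h a = npulls pi h a.
Proof.
elim=> [|{}h _ IH hp la|{}h _ IH hp la];
  rewrite ?nsucc_nil ?npulls_nil// nsucc_rcons npulls_rcons IH// ?muln1//.
by case: eqP => // e; move: hp; rewrite /p e la ltxx.
Qed.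

Definition excess (s : R) h a : R := s * ((nsucc h a)%:R - (npulls pi h a)%:R * lambda a).

Lemma few_pulls_bound (T : nat) (n0 : R) a : 0 <= n0 ->
  \sum_(t < T) tree_mean p t
     (fun h => ((pi h == a) && ((npulls pi h a)%:R < n0))%:R) <= n0 + 1.
Proof.
move=> n00.
(* Each counted pull lowers [V] by exactly 1, since fewer than [n0] pulls leave the maximum at its
   second argument. *)
pose V h := Num.max 0 (n0 + 1 - (npulls pi h a)%:R).
have -> : n0 + 1 = V [::].
  by rewrite /V npulls_nil subr0 max_r// addr_ge0.
apply: tree_mean_potential => // h; first by rewrite /V le_max lexx.
move=> _ _; rewrite /next_mean /V !npulls_rcons -mulrDl addrCA subrr addr0 mul1r.
case: eqP => _ /=; last by rewrite addn0 addr0.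
case: ltP => nn /=; last first.
  by rewrite addr0 natrD; rewrite ge_max le_max lexx /= le_max; apply/orP; right; lra.
by rewrite natrD !max_r; lra.
Qed.

(* The potential is the exponential supermartingale of the excess at a fixed
   parameter [th]; past [n0] pulls the negative drift [- c] makes it decrease by
   a factor [exp (- u)] at each pull, which pays for the counted ones. Taking
   [th] of order [1 / sqrt n0] makes the bound of order [sqrt n0]. *)
Lemma bad_pulls_bound (T : nat) (n0 c s th : R) a : 0 <= n0 -> 0 < c <= 1 ->
  `|s| = 1 -> 0 < th <= 2^-1 * c ->
  \sum_(t < T) tree_mean p t (fun h =>
     [&& pi h == a, n0 <= (npulls pi h a)%:R &
        c * ((npulls pi h a)%:R - n0) <= excess s h a]%:R)
  <= 4 / (c * th) * expR (th ^+ 2 * n0).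
Proof.
move=> n00 /andP[c0 c1] s1 /andP[th0 thc].
have s2 : s ^+ 2 = 1 by rewrite -real_normK ?num_real// s1 expr1n.
set u := c * th - th ^+ 2; set K := 4 / (c * th) * expR (th ^+ 2 * n0).
have u0 : 2^-1 * (c * th) <= u by rewrite /u; nra.
have cth : 0 < c * th by exact: mulr_gt0.
have K0 : 0 < K by rewrite mulr_gt0 ?expR_gt0// divr_gt0.
(* Each pull costs [th ^+ 2], the bound on the log-moment generating function of a centred feedback;
   pulls past [n0] are discounted by a further [u]. *)
pose D (n : R) := th ^+ 2 * n + u * Num.max 0 (n - n0).
pose V h := K * expR (th * excess s h a - D (npulls pi h a)%:R).
have -> : K = V [::].
  rewrite /V /D /excess nsucc_nil npulls_nil mul0r subr0 !mulr0 max_l; last by lra.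
  by rewrite !mulr0 addr0 subr0 expR0 mulr1.
apply: tree_mean_potential => // h; first by rewrite /V mulr_ge0 ?expR_ge0// ltW.
move=> _ _; rewrite /next_mean /V /excess !npulls_rcons !nsucc_rcons.
have [pia|pia] /= := eqVneq (pi h) a; last by rewrite mul0n !addn0; lra.
rewrite muln1 muln0 addn0 /p pia !natrD.
set n := (npulls pi h a)%:R; set x := (nsucc h a)%:R; set l := lambda a.
have -> : th * (s * (x + 1 - (n + 1) * l)) - D (n + 1) =
  (th * (s * (x - n * l)) - D n) + (D n - D (n + 1)) + th * s * (1 - l) by ring.
have -> : th * (s * (x - (n + 1) * l)) - D (n + 1) =
  (th * (s * (x - n * l)) - D n) + (D n - D (n + 1)) + - (th * s * l) by ring.
set e := th * (s * (x - n * l)) - D n; set dD := D n - D (n + 1).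
rewrite !(expRD (e + dD)).
have m1 : l * expR (th * s * (1 - l)) + (1 - l) * expR (- (th * s * l)) <= expR (th ^+ 2).
  have := @bernoulli_mgf_le R l (th * s) (lambda01 a).
  by rewrite exprMn s2 mulr1; apply; rewrite normrM s1 mulr1 gtr0_norm//; lra.
have Ke0 : 0 < K * expR (e + dD) by rewrite mulr_gt0 ?expR_gt0.
have m2 : l * (K * (expR (e + dD) * expR (th * s * (1 - l)))) +
   (1 - l) * (K * (expR (e + dD) * expR (- (th * s * l))))
   <= K * expR e * expR (dD + th ^+ 2).
  have -> : K * expR e * expR (dD + th ^+ 2) = K * expR (e + dD) * expR (th ^+ 2).
    by rewrite (expRD dD) (expRD e); ring.
  by have := ler_wpM2l (ltW Ke0) m1; lra.
have maxn : Num.max 0 (n - n0) <= Num.max 0 (n + 1 - n0).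
  by rewrite ge_max le_max lexx /= le_max; apply/orP; right; lra.
have Ke : 0 < K * expR e by rewrite mulr_gt0 ?expR_gt0.
have [nn|nn] /= := leP n0 n; last first.
  rewrite addr0; apply: le_trans m2 _.
  rewrite ler_piMr ?(ltW Ke)// -expR0 ler_expR /dD /D; nra.
have dE : dD + th ^+ 2 = - u.
  by rewrite /dD /D !max_r; [ring|lra|lra].
rewrite dE in m2; apply: le_trans (lerD m2 (lexx _)) _.
have hu : expR (- u) <= (1 + u)^-1.
  rewrite expRN lef_pV2 ?posrE ?expR_gt0//; last by lra.
  exact: expR_ge1Dx.
have u1 : u <= 1 by rewrite /u; nra.
have hu2 : expR (- u) <= 1 - u / 2.
  apply: le_trans hu _; rewrite -[leLHS]mul1r ler_pdivrMr; nra.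
have [bad|bad] /= := boolP (c * (n - n0) <= _); last first.
  by rewrite addr0; have := expR_gt0 (- u); nra.
(* On a counted pull the terms in [n] cancel, because [u + th ^+ 2 = c * th]. So [V] is at least
   [4 / (c * th)] before the pull, and losing the fraction [u / 2 >= c * th / 4] of it pays 1. *)
have ge : - (th ^+ 2 * n0) <= e.
  rewrite /e /D max_r ?subr_ge0// /u.
  by have := ler_wpM2l (ltW th0) bad; rewrite /l; nra.
suff : 1 <= K * expR e * (u / 2) by nra.
have : 4 / (c * th) <= K * expR e.
  rewrite /K -mulrA -expRD ler_peMr ?divr_ge0 ?(ltW cth)// -expR0 ler_expR; lra.
move=> h1; apply: le_trans (ler_pM _ _ h1 (_ : c * th / 4 <= u / 2)); last by lra.
- by rewrite mulrA mulfVK ?divff// gt_eqF.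
- by rewrite divr_ge0// ltW.
- by rewrite divr_ge0// ltW.
Qed.

End Counts.

(** * Deviations of the empirical feedback *)

Section Deviation.
Context {R : realType}.

(* Likelihood ratio of Ber(x) against Ber(l) after [s] successes in [n] trials. *)
Definition lik_ratio (l x : R) (n s : nat) : R :=
  (x / l) ^+ s * ((1 - x) / (1 - l)) ^+ (n - s).

Lemma expR_natM_ln (n : nat) (z : R) : 0 < z -> expR (n%:R * ln z) = z ^+ n.
Proof. by move=> z0; rewrite expRM_natl lnK. Qed.

(** The logarithms of the two sides differ by [(s - n x) logit_diff x l], and [logit_diff x l] has
    the sign of [x - l]. The ends [x = 0] and [x = 1] are treated apart because [ln 0] is a default
    value. *)
Lemma lik_ratio_ge (l x : R) (n s : nat) : 0 < l < 1 -> 0 <= x <= 1 ->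
  (s <= n)%N -> 0 <= (s%:R - n%:R * x) * (x - l) ->
  expR (n%:R * klr x l) <= lik_ratio l x n s.
Proof.
move=> /andP[l0 l1] /andP[x0 x1] sn; rewrite /lik_ratio.
have m0 : 0 < 1 - l by rewrite subr_gt0.
move: x0; rewrite le_eqVlt => /predU1P[<-|x0].
  rewrite mulr0 subr0 sub0r mulrN oppr_ge0 pmulr_lle0// => s0.
  have -> : s = 0%N by apply/eqP; rewrite -leqn0 -(ler_nat R).
  by rewrite expr0 mul1r subn0 /klr mul0r add0r subr0 mul1r expR_natM_ln// divr_gt0.
move: x1; rewrite le_eqVlt => /predU1P[->|x1].
  rewrite mulr1 pmulr_lge0// subr_ge0 ler_nat => ns.
  have -> : s = n by apply/eqP; rewrite eqn_leq sn.
  by rewrite subnn expr0 mulr1 /klr subrr mul0r addr0 mul1r expR_natM_ln// divr_gt0.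
move=> h; rewrite -!expR_natM_ln ?divr_gt0 ?subr_gt0// -expRD ler_expR natrB//.
suff : 0 <= (s%:R - n%:R * x) * logit_diff x l by rewrite /klr /logit_diff; lra.
case: (ltgtP x l) h => [xl|lx|->] h; last 1 first.
- by rewrite /logit_diff !divff ?gt_eqF// subrr mulr0.
- by apply: mulr_le0; [nra|exact/ltW/logit_diff_lt0].
- by apply: mulr_ge0; [nra|exact/ltW/logit_diff_gt0].
Qed.

(* On a slice of values of [n] where [ln n] varies by at most [1/F], one value
   [x], namely the empirical mean closest to [l] in the event, serves as the
   alternative for the whole slice. *)
Lemma slice_lik_ratio (l F : R) (t i : nat) (sg : R) : 0 < l < 1 -> 0 <= F ->
  exists2 x : R, 0 <= x <= 1 & forall n s : nat, (0 < n)%N -> (s <= n)%N ->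
    (n <= t)%N -> Num.truncn (F * ln n%:R) = i -> 0 < sg * (s%:R / n%:R - l) ->
    F < n%:R * klr (s%:R / n%:R) l -> expR (F - 1) <= lik_ratio l x n s.
Proof.
move=> l01 F0.
(* Pairs (trials, successes) of the event in this slice: there are finitely many, so a mean closest
   to [l] exists. *)
pose ev (u : 'I_t.+1 * 'I_t.+1) := [&& (0 < u.1)%N, (u.2 <= u.1)%N,
  Num.truncn (F * ln u.1%:R) == i, 0 < sg * (u.2%:R / u.1%:R - l) &
  F < u.1%:R * klr (u.2%:R / u.1%:R) l].
have evI n s (nt : (n <= t)%N) (sn : (s <= n)%N) : (0 < n)%N ->
    Num.truncn (F * ln n%:R) = i -> 0 < sg * (s%:R / n%:R - l) ->
    F < n%:R * klr (s%:R / n%:R) l ->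
    ev (Ordinal (nt : (n < t.+1)%N), Ordinal (leq_trans sn nt : (s < t.+1)%N)).
  by move=> n0 e h1 h2; rewrite /ev /= n0 sn e eqxx h1 h2.
case: (pickP ev) => [u0 eu0|noev]; last first.
  exists l => [|n s n0 sn nt e h1 h2]; first by case/andP: l01 => ? ?; rewrite !ltW.
  by have := evI n s nt sn n0 e h1 h2; rewrite noev.
case: (arg_minP (fun u : 'I_t.+1 * 'I_t.+1 => sg * (u.2%:R / u.1%:R - l)) eu0) => -[n1 s1].
rewrite /ev /= => /and5P[n10 s1n1 /eqP e1 g1 k1] minu.
have N1 : 0 < n1%:R :> R by rewrite ltr0n.
exists (s1%:R / n1%:R).
  by rewrite divr_ge0//= ler_pdivrMr// mul1r ler_nat.
move=> n s n0 sn nt e h1 h2.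
have := minu _ (evI n s nt sn n0 e h1 h2); rewrite /=.
have N0 : 0 < n%:R :> R by rewrite ltr0n.
set x := s1%:R / n1%:R in g1 k1 *; set y := s%:R / n%:R in h1 h2 * => xy.
have sE : s%:R = n%:R * y by rewrite mulrC divfK// gt_eqF.
have k0 : 0 < klr x l by rewrite -(pmulr_rgt0 _ N1) (le_lt_trans F0).
apply: le_trans (lik_ratio_ge l01 _ sn _); last 2 first.
- by rewrite divr_ge0//= ler_pdivrMr// mul1r ler_nat.
- rewrite sE -mulrBr -mulrA mulr_ge0//.
  have sg2 : 0 < sg ^+ 2.
    by rewrite exprn_even_gt0//; apply: contraTneq g1 => ->; rewrite mul0r ltxx.
  rewrite -(pmulr_rge0 _ sg2).
  have -> : sg ^+ 2 * ((y - x) * (x - l)) =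
    (sg * (y - l) - sg * (x - l)) * (sg * (x - l)) by ring.
  by rewrite mulr_ge0 ?subr_ge0// ltW.
rewrite ler_expR.
(* Both values of [F * ln] have integer part [i], so they differ by less than 1; hence
   [F * (n / n1) >= F - 1], and the exponent loses only 1. *)
have lnn : F * (ln n1%:R - ln n%:R) <= 1.
  have ln0 (m : nat) : (0 < m)%N -> 0 <= F * ln m%:R.
    by move=> m0; rewrite mulr_ge0// ln_ge0// ler1n.
  have /andP[_ a] := truncn_itv (ln0 _ n10); have /andP[b _] := truncn_itv (ln0 _ n0).
  by rewrite e1 -natr1 in a; rewrite e in b; lra.
have ratio : 1 - (ln n1%:R - ln n%:R) <= n%:R / n1%:R :> R.
  have -> : n%:R / n1%:R = expR (ln n%:R - ln n1%:R) :> R.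
    by rewrite expRB !lnK ?posrE.
  by apply: le_trans (expR_ge1Dx _); lra.
apply: (@le_trans _ _ (F * (n%:R / n1%:R))).
  by have := ler_wpM2l F0 ratio; lra.
have : F / n1%:R <= klr x l by rewrite ler_pdivrMr// mulrC ltW.
by move=> /(ler_wpM2l (ltW N0)); lra.
Qed.

Section OneArm.
Context {k : nat}.
Variables (pi : policy k) (lambda : 'I_k.+1 -> R).
Hypothesis lambda01 : forall a, 0 <= lambda a <= 1.
Let p h := lambda (pi h).
Let p01 h : 0 <= p h <= 1. Proof. exact: lambda01. Qed.

(** Under the true law the ratio is a martingale: [l (x / l) + (1 - l) ((1 - x) / (1 - l)) = 1]. *)
Lemma tree_mean_lik_ratio (x : R) a t : 0 < lambda a < 1 ->
  tree_mean p t (fun h => lik_ratio (lambda a) x (npulls pi h a) (nsucc pi h a)) = 1.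
Proof.
move=> /andP[l0 l1]; rewrite tree_mean_martingale.
  by rewrite npulls_nil nsucc_nil /lik_ratio !expr0 mulr1.
move=> h; rewrite /next_mean /lik_ratio !npulls_rcons !nsucc_rcons.
have [pia|_] /= := eqVneq (pi h) a; last by rewrite mul0n !addn0; ring.
rewrite muln1 muln0 addn0 /p pia subnDr -addnBAC ?nsucc_le_npulls//.
rewrite !exprD !expr1; set A := _ ^+ _; set B := _ ^+ _.
have l0' := lt0r_neq0 l0; have l1' : 1 - lambda a != 0 by rewrite gt_eqF ?subr_gt0.
by field; rewrite l0' l1'.
Qed.

Definition deviates (F : R) a h : bool :=
  (F%:E < (npulls pi h a)%:R%:E * kl (mean_feedback pi h a) (lambda a))%E.

(** A degenerate arm never deviates on a reachable list: once pulled, its empirical mean is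
    [lambda a] and the divergence is 0. *)
Lemma deviates_klr (F : R) a h : 0 <= F -> reachable p h -> deviates F a h ->
  [/\ 0 < lambda a < 1, (0 < npulls pi h a)%N, mean_feedback pi h a != lambda a &
     F < (npulls pi h a)%:R * klr (mean_feedback pi h a) (lambda a)].
Proof.
move=> F0 rh; rewrite /deviates => dev.
have n0 : (0 < npulls pi h a)%N.
  by rewrite lt0n; apply: contraTneq dev => ->; rewrite mul0e -leNgt lee_fin.
have neq : mean_feedback pi h a != lambda a.
  apply: contraTneq dev => ->; rewrite kl_refl ?lambda01//.
  by rewrite mule0 -leNgt lee_fin.
have l01 : 0 < lambda a < 1.
  have /andP[] := lambda01 a; rewrite !le_eqVlt => /predU1P[l0|->].
    by move: neq; rewrite mean_feedbackE (nsucc_reachable0 rh)// mul0r -l0 eqxx.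
  case/predU1P=> // l1; move: neq.
  by rewrite mean_feedbackE (nsucc_reachable1 rh)// l1 divff ?eqxx// pnatr_eq0 -lt0n.
split=> //; move: dev; rewrite klE ?lte_fin//.
by case/andP: l01 => l0 l1; rewrite (gt_eqF l0) (lt_eqF l1) !ltW.
Qed.

(** A Markov argument and a union bound over the side of the deviation and the slices: the indicator
    is at most [expR (1 - F)] times the sum of [2 (m + 1)] likelihood ratios, each of mean 1. *)
Lemma deviation_bound (F : R) a (t : nat) : 0 <= F -> (0 < t)%N ->
  tree_mean p t (fun h => (deviates F a h)%:R)
  <= 2 * (F * ln t%:R + 1) * expR (1 - F).
Proof.
move=> F0 t0.
have Ft0 : 0 <= F * ln t%:R by rewrite mulr_ge0// ln_ge0// ler1n.
have [l01|l01] := boolP (0 < lambda a < 1); last first.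
  apply: (@le_trans _ _ 0); last by rewrite !mulr_ge0 ?expR_ge0// addr_ge0.
  rewrite -[leRHS](@tree_mean_cst _ p t); apply: tree_mean_le => // h _ rh.
  by case: (boolP (deviates _ _ _)) => // /(deviates_klr F0 rh)[]; rewrite (negbTE l01).
set m := Num.truncn (F * ln t%:R).
have /choice[x Hx] : forall u : bool * 'I_m.+1, exists x : R, 0 <= x <= 1 /\
    forall n s : nat, (0 < n)%N -> (s <= n)%N ->
    (n <= t)%N -> Num.truncn (F * ln n%:R) = u.2 ->
    0 < (-1) ^+ u.1 * (s%:R / n%:R - lambda a) ->
    F < n%:R * klr (s%:R / n%:R) (lambda a) ->
    expR (F - 1) <= lik_ratio (lambda a) x n s.
  by move=> u; have [x x01 xP] := @slice_lik_ratio (lambda a) F t u.2 ((-1) ^+ u.1) l01 F0;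
     exists x.
pose L u h := lik_ratio (lambda a) (x u) (npulls pi h a) (nsucc pi h a).
apply: (@le_trans _ _ (tree_mean p t (fun h => expR (1 - F) * \sum_u L u h))).
  apply: tree_mean_le => // h sh rh.
  have L0 u : 0 <= L u h.
    have [/andP[x0 x1] _] := Hx u; case/andP: l01 => l0 l1.
    by rewrite mulr_ge0// exprn_ge0// divr_ge0 ?subr_ge0// ltW.
  case: (boolP (deviates _ _ _)) => /= [/(deviates_klr F0 rh)|_]; last first.
    by rewrite mulr_ge0 ?expR_ge0 ?sumr_ge0.
  move=> [_ n0 neq dev].
  have nt : (npulls pi h a <= t)%N by rewrite -sh npulls_le_size.
  have im : (Num.truncn (F * ln (npulls pi h a)%:R) < m.+1)%N.
    rewrite ltnS le_truncn// ler_wpM2l// ler_ln ?posrE ?ltr0n// ler_nat//.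
  pose u := (mean_feedback pi h a < lambda a, Ordinal im).
  have [_ /(_ (npulls pi h a) (nsucc pi h a) n0 (nsucc_le_npulls _ _ _) nt erefl)] := Hx u.
  rewrite -mean_feedbackE => /(_ _ dev) key.
  have : expR (F - 1) <= L u h.
    apply: key; rewrite /u /=; case: (ltgtP (mean_feedback pi h a) (lambda a)) neq => // d _; rewrite ?expr1 ?expr0; lra.
  move=> Lu; apply: (@le_trans _ _ (expR (1 - F) * L u h)).
    rewrite -[leLHS]expR0 (_ : 0 = (1 - F) + (F - 1)); last by ring.
    by rewrite expRD ler_pM2l ?expR_gt0.
  rewrite ler_pM2l ?expR_gt0// (bigD1 u)//= lerDl sumr_ge0//.
rewrite tree_meanZ tree_mean_sum (eq_bigr (fun=> 1)); last first.
  by move=> u _; rewrite tree_mean_lik_ratio.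
rewrite sumr_const card_prod card_bool card_ord natrM mulrC ler_wpM2r ?expR_ge0//.
by rewrite ler_wpM2l// -natr1 lerD2r truncn_le.
Qed.

End OneArm.

(** * Estimates for the exploration function *)

Lemma ln_nat_ge1 (t : nat) : (4 <= t)%N -> 1 <= ln t%:R :> R.
Proof.
move=> t4; rewrite -ler_expR lnK ?posrE ?ltr0n; last by apply: leq_trans t4.
apply: (@le_trans _ _ 4%:R); last by rewrite ler_nat.
(* [e <= 4], as the quadratic bound at [2^-1] gives [sqrt e <= 2]. *)
have -> : 1 = 2^-1 + 2^-1 :> R by lra.
rewrite expRD; have := @expR_le_quad R 2^-1 (lexx _); have := expR_gt0 (2^-1 : R); nra.
Qed.

(** [1 / t <= ln t - ln (t - 1)], and the right side factors as a difference of squares. The aim is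
    a telescoping majorant of [1 / (t ln t)] whose sum is [O(sqrt (ln T))]. *)
Lemma sqrt_ln_increment (t : nat) : (4 <= t)%N ->
  (t%:R * ln t%:R)^-1 <= 2 * (Num.sqrt (ln t%:R) - Num.sqrt (ln t.-1%:R)) :> R.
Proof.
move=> t4; have L1 := ln_nat_ge1 t4.
have t0 : 0 < t%:R :> R by rewrite ltr0n (leq_trans _ t4).
have t1 : 0 < t.-1%:R :> R by rewrite ltr0n -ltnS prednK (leq_trans _ t4).
set q := Num.sqrt (ln t%:R); set q' := Num.sqrt (ln t.-1%:R).
have q1 : 1 <= q by rewrite -[leLHS]sqrtr1 ler_wsqrtr.
have q'0 : 0 <= q' by exact: sqrtr_ge0.
have qE : q ^+ 2 = ln t%:R by rewrite sqr_sqrtr// (le_trans ler01).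
have q'E : q' ^+ 2 = ln t.-1%:R by rewrite sqr_sqrtr// ln_ge0// ler1n -(ltr0n R).
have inc : t%:R^-1 <= ln t%:R - ln t.-1%:R :> R.
  have : ln t.-1%:R - ln t%:R <= - t%:R^-1 :> R.
    rewrite -ln_div ?posrE// -subn1 natrB ?(leq_trans _ t4)// mulrBl mul1r divff ?gt_eqF//.
    by rewrite le_ln1Dx// ltrN2 invf_lt1// ltr1n (leq_trans _ t4).
  lra.
have qq : q' <= q.
  by rewrite ler_wsqrtr// ler_ln ?posrE// ler_nat leq_pred.
rewrite -qE invfM.
have tq : t%:R^-1 <= (q - q') * (2 * q) by nra.
have i0 : 0 < t%:R^-1 :> R by rewrite invr_gt0.
rewrite -/(_ / _) ler_pdivrMr ?exprn_gt0//; last by lra.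
nra.
Qed.

Lemma exploration_bounds (t : nat) : (4 <= t)%N ->
  let L := ln t%:R : R in L <= L + 3 * ln L <= L + 6 * Num.sqrt L.
Proof.
move=> t4 /=; have L1 := ln_nat_ge1 t4; rewrite lerDl mulr_ge0 ?ln_ge0//=.
have q1 : 1 <= Num.sqrt (ln t%:R) :> R by rewrite -[leLHS]sqrtr1 ler_wsqrtr.
rewrite -[in ln (ln _)](@sqr_sqrtr _ (ln t%:R)) ?(le_trans ler01)//.
rewrite lnXn ?(lt_le_trans ltr01)// lerD2l.
have /ltW := @ln_sublinear R (Num.sqrt (ln t%:R)) (lt_le_trans ltr01 q1).
lra.
Qed.

(** [expR (- F) = 1 / (t L^3)] and [F <= 4 L]: two of the three powers of [L] absorb the number of
    slices, leaving [O(1 / (t L))]. *)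
Lemma exploration_deviation (t : nat) (F : R) : (4 <= t)%N ->
  F = ln t%:R + 3 * ln (ln t%:R) ->
  2 * (F * ln t%:R + 1) * expR (1 - F)
  <= 20 * expR 1 * (Num.sqrt (ln t%:R) - Num.sqrt (ln t.-1%:R)).
Proof.
move=> t4 FE; have L1 := ln_nat_ge1 t4; set L := ln t%:R in FE L1 *.
have L0 : 0 < L by lra.
have t0 : 0 < t%:R :> R by rewrite ltr0n (leq_trans _ t4).
have F4 : F <= 4 * L by rewrite FE; have := @ln_sublinear R L L0; lra.
have -> : expR (1 - F) = expR 1 * (t%:R * L)^-1 * (L ^+ 2)^-1.
  rewrite FE expRB expRD /L lnK ?posrE// -/L (expRM_natl 3) lnK ?posrE//.
  by field; rewrite !gt_eqF.
apply: (@le_trans _ _ (10 * expR 1 * (t%:R * L)^-1)).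
  rewrite mulrA ler_pdivrMr ?exprn_gt0//.
  have e0 : 0 < expR 1 * (t%:R * L)^-1 by rewrite mulr_gt0 ?expR_gt0// invr_gt0 mulr_gt0.
  have : 2 * (F * L + 1) <= 10 * L ^+ 2 by nra.
  by move=> /(ler_wpM2r (ltW e0)); lra.
have := sqrt_ln_increment t4; rewrite -/L.
by move=> /(ler_wpM2l (expR_ge0 (1 : R))); lra.
Qed.

End Deviation.

(** * Number of pulls of a suboptimal arm *)

Section ArmBound.
Context {R : realType}.

Lemma kl_gt0 (x y : R) : 0 <= x <= 1 -> x != y -> (0 < kl x y)%E.
Proof.
have above (u v : R) : 0 <= u <= 1 -> u < v -> (0 < kl u v)%E.
  move=> /andP[u0 u1] uv; have [->|] := eqVneq (kl u v) +oo%E; first exact: ltry.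
  rewrite -ltey => /kl_lty[/andP[_ v1] _ h ->].
  rewrite lte_fin klr_gt0// lt_neqAle v1 andbT.
  by apply: contraTneq uv => ve; rewrite h// ve ltxx.
move=> x01; rewrite neq_lt => /orP[xy|yx]; first exact: above.
rewrite -klN; apply: above; last by lra.
by case/andP: x01 => x0 x1; apply/andP; split; lra.
Qed.

Lemma inv_kl_ge0 (x y : R) : 0 <= x <= 1 -> 0 <= inv_kl x y.
Proof.
move=> x01; rewrite /inv_kl fine_ge0// inve_ge0.
have [<-|xy] := eqVneq x y; first by rewrite kl_refl.
exact/ltW/kl_gt0.
Qed.

(** [x != y] excludes a zero divergence, whose extended inverse is [+oo]; an infinite divergence
    gives 0 on both sides. *)
Lemma inv_klEFin (x y : R) : 0 <= x <= 1 -> x != y -> (inv_kl x y)%:E = (kl x y)^-1%E.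
Proof.
move=> x01 xy; have k0 := kl_gt0 x01 xy.
by rewrite fineK// fin_numV ?gt_eqF// (lt_trans _ k0)// ltNyr.
Qed.

Context {k : nat}.
Variables (mu lambda : 'I_k.+1 -> R) (g : 'I_k.+1 -> R -> R) (f : nat -> R).
Hypothesis bandit : corrupt_bandit mu lambda g.
Hypothesis g_mono : forall a, strictly_monotone01 (g a).
Hypothesis f_homo : {homo f : s t / (s <= t)%N >-> s <= t}.

Let lambda01 a : 0 <= lambda a <= 1. Proof. by have [] := bandit a. Qed.

Lemma corruption_neq a : mu a < mu ord0 -> lambda a != g a (mu ord0).
Proof.
move=> lt; case: (bandit a) => a01 _ _ <-; have [z01 _ _ _] := bandit ord0.
by case: (g_mono a) => H; have := H _ _ a01 z01 lt; [move/lt_eqF->|move/gt_eqF->].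
Qed.

(** Going from [mu a] to [mu ord0] and on to [q] moves [g a] twice in the same direction, whether it
    increases or decreases. *)
Lemma corruption_sg a q : mu a < mu ord0 -> mu ord0 <= q -> q <= 1 ->
  0 <= Num.sg (g a (mu ord0) - lambda a) * (g a q - g a (mu ord0)).
Proof.
move=> lt le q1; case: (bandit a) => a01 _ _ <-; have [z01 _ _ _] := bandit ord0.
have q01 : q \in `[0, 1] by rewrite in_itv /= q1 andbT (le_trans _ le)//; case/andP: z01.
move: le; rewrite le_eqVlt => /predU1P[<-|lt']; first by rewrite subrr mulr0.
case: (g_mono a) => H; have h := H _ _ a01 z01 lt; have h' := H _ _ z01 q01 lt'.
  by rewrite gtr0_sg ?subr_gt0// mul1r subr_ge0 ltW.
by rewrite ltr0_sg ?subr_lt0// mulN1r opprB subr_ge0 ltW.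
Qed.

Lemma index_set_not_deviates (pi : policy k) h a :
  ~~ deviates pi lambda (f (size h)) a h -> index_set g f pi h a (mu a).
Proof.
have [a01 _ _ ga] := bandit a.
by rewrite /deviates -leNgt => dev; split; rewrite ?ga.
Qed.

(** Without deviations both index sets are nonempty, so the indices are true maxima, and the index
    of [a] dominates that of [ord0], hence [mu ord0]. It is the witness [q]. *)
Lemma kl_ucb_pull (T : nat) (pi : policy k) h a : kl_ucb_cf g f T pi ->
  (k.+1 <= size h < T)%N -> pi h = a ->
  ~~ deviates pi lambda (f (size h)) ord0 h -> ~~ deviates pi lambda (f (size h)) a h ->
  exists q, [/\ mu ord0 <= q, q <= 1 &
    ((npulls pi h a)%:R%:E * kl (mean_feedback pi h a) (g a q) <= (f T)%:E)%E].
Proof.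
move=> [_ ucb] sh pia /index_set_not_deviates S0 /index_set_not_deviates Sa.
have [index [maxi lei]] := ucb h sh.
have [_ /(_ _ S0) m0] := maxi ord0 (ex_intro _ _ S0).
have [[/andP[_ q1] kq] _] := maxi a (ex_intro _ _ Sa).
exists (index a); split => //; first by rewrite (le_trans m0)// -pia.
apply: le_trans kq _; rewrite lee_fin f_homo//.
by case/andP: sh => _ /ltnW.
Qed.

Hypothesis fE : forall t : nat, (3 <= t)%N -> f t = ln t%:R + 3 * ln (ln t%:R).

Lemma f_bounds (t : nat) : (4 <= t)%N ->
  0 <= f t /\ f t <= ln t%:R + 6 * Num.sqrt (ln t%:R).
Proof.
move=> t4; have /andP[a b] := @exploration_bounds R t t4.
by rewrite fE ?(leq_trans _ t4)//; split=> //; apply: le_trans a; have := @ln_nat_ge1 R t t4; lra.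
Qed.

Lemma sum_sqrt_ln_increment (n : nat) :
  \sum_(t < n) (Num.sqrt (ln t%:R) - Num.sqrt (ln t.-1%:R)) = Num.sqrt (ln n.-1%:R) :> R.
Proof.
elim: n => [|n IH]; first by rewrite big_ord0 ln0// sqrtr0.
by rewrite big_ord_recr /= IH addrCA subrr addr0.
Qed.

Lemma sqrt_ln_homo (s t : nat) : (s <= t)%N ->
  Num.sqrt (ln s%:R) <= Num.sqrt (ln t%:R) :> R.
Proof.
case: s => [|s] st; first by rewrite ln0// sqrtr0 sqrtr_ge0.
by rewrite ler_wsqrtr// ler_ln ?posrE ?ltr0n ?ler_nat// (leq_trans _ st).
Qed.

Lemma arm_bound a : mu a < mu ord0 -> exists C : R, forall T : nat,
  (k.+1 <= T)%N -> (4 <= T)%N -> forall pi : policy k, kl_ucb_cf g f T pi ->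
  \sum_(t < T) tree_mean (fun h => lambda (pi h)) t (fun h => (pi h == a)%:R)
  <= inv_kl (lambda a) (g a (mu ord0)) * ln T%:R + C * Num.sqrt (ln T%:R).
Proof.
move=> lt; have neq := corruption_neq lt.
have [c /andP[c0 c1] dev] := kl_le_deviation (lambda01 a) neq.
set y1 := g a (mu ord0) in neq dev *; set kap := inv_kl _ _ in dev *.
have kap0 : 0 <= kap by exact: inv_kl_ge0.
pose t0 := maxn k.+1 4.
(* In order: the first [t0] rounds, the deviations of the two arms, the excess of [n0 + 1] over
   [kap * ln T], and the pulls counted by [bad]. *)
exists (t0%:R + 40 * expR 1 + (6 * kap + 1) + 8 / c ^+ 2 * expR (2 * kap)).
move=> T kT T4 pi ucb; set p := fun h => lambda (pi h).
have p01 h : 0 <= p h <= 1 by exact: lambda01.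
set s := Num.sg (y1 - lambda a) in dev.
have s1 : `|s| = 1 by rewrite normr_sg subr_eq0 eq_sym neq.
have [fT0 fT1] := f_bounds T4.
set n0 := kap * f T; have n00 : 0 <= n0 by exact: mulr_ge0.
pose few h : R := ((pi h == a) && ((npulls pi h a)%:R < n0))%:R.
pose bad h : R := [&& pi h == a, n0 <= (npulls pi h a)%:R &
   c * ((npulls pi h a)%:R - n0) <= excess pi lambda s h a]%:R.
set q := Num.sqrt (ln T%:R) in fT1 *.
have L1 : 1 <= ln T%:R :> R := ln_nat_ge1 T4.
have q1 : 1 <= q by rewrite -[leLHS]sqrtr1 ler_wsqrtr.
have qE : q ^+ 2 = ln T%:R by rewrite sqr_sqrtr// (le_trans ler01).
(* [th * q = c / 2] keeps [th ^+ 2 * n0] bounded, since [n0] is [O(q ^+ 2)], while [1 / th] is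
   [O(q)]. *)
pose th := 2^-1 * c / q.
have th0 : 0 < th by rewrite divr_gt0 ?mulr_gt0//; lra.
have thq : th * q = 2^-1 * c by rewrite divfK// gt_eqF//; lra.
have thc : th <= 2^-1 * c by nra.
pose inc (t : nat) : R := 20 * expR 1 * (Num.sqrt (ln t%:R) - Num.sqrt (ln t.-1%:R)).
have inc0 t : 0 <= inc t.
  by rewrite mulr_ge0 ?mulr_ge0 ?expR_ge0// subr_ge0 sqrt_ln_homo// leq_pred.
have devb t b : (t0 <= t)%N -> tree_mean p t (fun h => (deviates pi lambda (f t) b h)%:R) <= inc t.
  rewrite geq_max => /andP[_ t4]; have [ft0 _] := f_bounds t4.
  apply: le_trans (@deviation_bound R k pi lambda lambda01 (f t) b t ft0 (ltnW (ltnW (ltnW t4)))) _.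
  by apply: exploration_deviation; rewrite // fE// (leq_trans _ t4).
have step (t : 'I_T) : tree_mean p t (fun h => (pi h == a)%:R) <=
    (t < t0)%N%:R + (inc t + inc t) + (tree_mean p t few + tree_mean p t bad).
  rewrite -tree_meanD; have [tt|tt] := ltnP t t0.
    apply: (@le_trans _ _ (1 + tree_mean p t (fun h => few h + bad h))); last first.
      by rewrite lerD2r lerDl addr_ge0.
    rewrite -[X in X + _](@tree_mean_cst _ p t) -tree_meanD; apply: tree_mean_le => // h _ _.
    by rewrite ler_wpDr ?addr_ge0 ?ler0n// lern1 leq_b1.
  rewrite add0r; apply: le_trans; last first.
    by apply: lerD (lexx _); apply: lerD; [apply: (devb t ord0)|apply: (devb t a)].
  rewrite -!tree_meanD; apply: tree_mean_le => // h sh rh.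
  have [pia|_] := eqVneq (pi h) a; last by rewrite !addr_ge0.
  rewrite -sh; have [_|d0] := boolP (deviates _ _ _ ord0 _); first by rewrite -addrA lerDl !addr_ge0.
  have [_|da] := boolP (deviates _ _ _ a _); first by rewrite add0r lerDl !addr_ge0.
  rewrite !add0r /few /bad pia eqxx /=.
  have [nn|nn] := ltP (npulls pi h a)%:R n0; first by rewrite lerDl.
  rewrite add0r /=; have sT : (k.+1 <= size h < T)%N.
    by rewrite sh ltn_ord andbT (leq_trans _ tt)// leq_maxl.
  have [r [r0 r1 kr]] := kl_ucb_pull ucb sT pia d0 da.
  have -> // : c * ((npulls pi h a)%:R - n0) <= excess pi lambda s h a.
  (* With no pull, [mean_feedback] is [0 / 0 = 0], which is not 1 when [lambda a = 1]; this case is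
     treated directly. *)
  have [N0|N0] := posnP (npulls pi h a).
    have := nsucc_le_npulls pi h a; rewrite /excess N0 leqn0 => /eqP ->.
    by rewrite mul0r subrr mulr0 sub0r mulrN oppr_le0 mulr_ge0// ltW.
  rewrite /excess -(npulls_mean_feedback pi) -mulrBr.
  apply: dev kr nn => //.
  - exact: mean_feedback_itv.
  - by move=> l0; rewrite mean_feedbackE (nsucc_reachable0 rh)// mul0r.
  - move=> l1; rewrite mean_feedbackE (nsucc_reachable1 rh)// divff//.
    by rewrite pnatr_eq0 -lt0n.
  - exact: corruption_sg.
apply: (le_trans (ler_sum _ (fun t _ => step t))).
rewrite !big_split /=.
have b1 : \sum_(t < T) (t < t0)%N%:R <= t0%:R :> R.
  rewrite -natr_sum ler_nat; elim: (T) => [|n IH]; first by rewrite big_ord0.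
  suff -> : (\sum_(t < n.+1) (t < t0) = minn n.+1 t0)%N by rewrite geq_minr.
  elim: n {IH} => [|n IH]; rewrite big_ord_recr /= ?IH ?big_ord0; lia.
have b2 : \sum_(t < T) inc t <= 20 * expR 1 * q.
  rewrite -mulr_sumr sum_sqrt_ln_increment ler_wpM2l ?mulr_ge0 ?expR_ge0//.
  by rewrite sqrt_ln_homo// leq_pred.
have b3 : \sum_(t < T) tree_mean p t few <= n0 + 1 by exact: few_pulls_bound.
have b4 : \sum_(t < T) tree_mean p t bad <= 4 / (c * th) * expR (th ^+ 2 * n0).
  by apply: bad_pulls_bound => //; apply/andP.
have t2 : th ^+ 2 * n0 <= 2 * kap.
  have hf : f T <= 7 * q ^+ 2 by rewrite -qE in fT1; nra.
  have : th ^+ 2 * q ^+ 2 <= 4^-1 by rewrite -exprMn thq; nra.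
  have thq0 : 0 <= th ^+ 2 by exact: sqr_ge0.
  move=> h; apply: (@le_trans _ _ (kap * (7 * (th ^+ 2 * q ^+ 2)))); last by nra.
  rewrite /n0 mulrCA ler_wpM2l//; nra.
have b5 : 4 / (c * th) * expR (th ^+ 2 * n0) <= 8 / c ^+ 2 * expR (2 * kap) * q.
  have -> : 4 / (c * th) = 8 / c ^+ 2 * q.
    by rewrite /th; field; rewrite !gt_eqF//; lra.
  by rewrite [leRHS]mulrAC ler_wpM2l ?ler_expR// mulr_ge0 ?divr_ge0 ?sqr_ge0//; lra.
have b6 : n0 <= kap * ln T%:R + 6 * kap * q.
  by rewrite /n0; have := ler_wpM2l kap0 fT1; lra.
have e0 : 0 <= expR 1 :> R by exact: expR_ge0.
have t00 : 0 <= t0%:R :> R by [].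
set X := 8 / c ^+ 2 * _ in b5 *.
have : t0%:R <= t0%:R * q by nra.
nra.
Qed.

End ArmBound.

(** * From the probability space to the feedback tree *)

Section RunLaw.
Context {R : realType} {k : nat} {d : measure_display} {Om : measurableType d}.
Variable P : probability Om R.
Implicit Types (X Fb Rw : nat -> {RV P >-> bool}) (A B : set Om).

Definition prob A : R := fine (P A).

Lemma measurable_history X (t : nat) (h : seq bool) :
  measurable [set w | history X t w = h].
Proof.
elim: t h => [|t IH] h.
  have -> : [set w | history X 0 w = h] = if h is [::] then setT else set0.
    by apply/seteqP; split=> w; case: h.
  by case: h.
case/lastP: h => [|h b].
  by rewrite (_ : [set _ | _] = set0)//; apply/seteqP; split=> w.
have -> : [set w | history X t.+1 w = rcons h b] =
    [set w | history X t w = h] `&` X t @^-1` [set b].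
  apply/seteqP; split=> w /=; rewrite /history mkseqS.
    by move/eqP; rewrite eqseq_rcons => /andP[/eqP ? /eqP ?].
  by move=> [-> ->].
by apply: measurableI => //; exact: measurable_funPTI.
Qed.

Lemma measure_history_split X (t : nat) (h : seq bool) A : measurable A ->
  P ([set w | history X t w = h] `&` A) =
  (P ([set w | history X t.+1 w = rcons h true] `&` A) +
   P ([set w | history X t.+1 w = rcons h false] `&` A))%E.
Proof.
move=> mA; rewrite -measureU; last 3 first.
- by apply: measurableI => //; exact: measurable_history.
- by apply: measurableI => //; exact: measurable_history.
- apply/seteqP; split=> w //= [[e1 _] [e2 _]]; move: e1; rewrite e2.
  by move/eqP; rewrite eqseq_rcons andbF.
congr (P _); apply/seteqP; split=> w /=; rewrite /history mkseqS.
  by move=> [-> Aw]; case: (X t w); [left|right].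
by move=> [[/eqP]|[/eqP]]; rewrite eqseq_rcons => /andP[/eqP].
Qed.

(** The factor [c] is the same for all lists [r], so the past values of [X] can be summed out one at
    a time. *)
Lemma history_marginal X (t : nat) A B (c : \bar R) :
  measurable A -> measurable B -> (0 <= c)%E ->
  (forall r, P ([set w | history X t w = r] `&` (A `&` B)) =
     (P ([set w | history X t w = r] `&` A) * c)%E) ->
  P (A `&` B) = (P A * c)%E.
Proof.
move=> mA mB c0; elim: t => [|t IH] H.
  have h0 : [set w | history X 0 w = [::]] = setT by apply/seteqP.
  by have := H [::]; rewrite h0 !setTI.
apply: IH => r; rewrite (measure_history_split X t r (measurableI _ _ mA mB)) (measure_history_split X t r mA).
by rewrite !H ge0_muleDl.
Qed.

Variables (mu lambda : 'I_k.+1 -> R) (pi : policy k) (T : nat).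
Variables Fb Rw : nat -> {RV P >-> bool}.
Hypothesis mu01 : forall a, 0 <= mu a <= 1.
Hypothesis lambda01 : forall a, 0 <= lambda a <= 1.
Hypothesis run : bandit_run mu lambda pi T Fb Rw.

(** The policy sees feedbacks only, so the conditional laws depend on the past through [h] alone and
    the past rewards can be summed out. *)
Lemma bandit_run_marginal (t : nat) (h : seq bool) (b : bool) : (t < T)%N ->
  prob ([set w | history Fb t w = h] `&` Fb t @^-1` [set b]) =
    prob [set w | history Fb t w = h] * (if b then lambda (pi h) else 1 - lambda (pi h)) /\
  prob ([set w | history Fb t w = h] `&` Rw t @^-1` [set b]) =
    prob [set w | history Fb t w = h] * (if b then mu (pi h) else 1 - mu (pi h)).
Proof.
move=> tT; pose A := [set w | history Fb t w = h].
have mA : measurable A by exact: measurable_history.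
have mpre (Y : {RV P >-> bool}) : measurable (Y @^-1` [set b]) by exact: measurable_funPTI.
have pastE r : [set w | history Rw t w = r] `&` A =
    [set w | history Fb t w = h /\ history Rw t w = r].
  by apply/seteqP; split=> w /= [].
have bern (c : bool) (q : R) : 0 <= q <= 1 ->
    bernoulli_prob q [set c] = (if c then q else 1 - q)%:E.
  move=> q01; rewrite bernoulli_probE// !diracE.
  have m e : (e \in [set c]) = (e == c) by apply/idP/eqP; rewrite inE.
  by rewrite !m; case: c {m} => /=; rewrite mule1 mule0 ?adde0 ?add0e.
have fin : P A \is a fin_num by exact: fin_num_measure.
split; rewrite /prob; have fineE (q : R) :
    fine (P A) * q = fine (P A * q%:E)%E by rewrite fineM.
- rewrite fineE -bern//; congr fine.
  apply: (@history_marginal Rw t) => // r.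
  by rewrite setIA pastE; have [-> _] := run h r [set b] tT.
- rewrite fineE -bern//; congr fine.
  apply: (@history_marginal Rw t) => // r.
  by rewrite setIA pastE; have [_ ->] := run h r [set b] tT.
Qed.

(** Recurses like [tree_mean], so that one induction on [t] compares the two. *)
Fixpoint seq_sum (t : nat) (F : seq bool -> R) : R :=
  if t is s.+1 then seq_sum s (fun h => F (rcons h true) + F (rcons h false)) else F [::].

Lemma seq_sum_history (X : nat -> {RV P >-> bool}) (t : nat) A : measurable A ->
  prob A = seq_sum t (fun h => prob ([set w | history X t w = h] `&` A)).
Proof.
move=> mA; elim: t => [|t IH] /=.
  have -> : [set w | history X 0 w = [::]] = setT by apply/seteqP.
  by rewrite setTI.
rewrite IH; congr seq_sum; apply/funext => h.
rewrite /prob measure_history_split// fineD//; apply: fin_num_measure;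
  by apply: measurableI => //; exact: measurable_history.
Qed.

Lemma tree_mean_history (t : nat) F : (t <= T)%N ->
  seq_sum t (fun h => prob [set w | history Fb t w = h] * F h) =
  tree_mean (fun h => lambda (pi h)) t F.
Proof.
elim: t F => [|t IH] F tT /=.
  have -> : [set w | history Fb 0 w = [::]] = setT by apply/seteqP.
  by rewrite /prob probability_setT mul1r.
rewrite -IH ?(ltnW tT)//; congr seq_sum; apply/funext => h.
have E b : [set w | history Fb t.+1 w = rcons h b] =
    [set w | history Fb t w = h] `&` Fb t @^-1` [set b].
  apply/seteqP; split=> w /=; rewrite /history mkseqS.
    by move/eqP; rewrite eqseq_rcons => /andP[/eqP ? /eqP ?].
  by move=> [-> ->].
have [Et _] := bandit_run_marginal h true tT.
have [Ef _] := bandit_run_marginal h false tT.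
by rewrite !E Et Ef /next_mean; ring.
Qed.

Lemma reward_prob (t : nat) : (t < T)%N ->
  prob (Rw t @^-1` [set true]) = tree_mean (fun h => lambda (pi h)) t (fun h => mu (pi h)).
Proof.
move=> tT; rewrite (@seq_sum_history Fb t); last exact: measurable_funPTI.
rewrite -tree_mean_history ?(ltnW tT)//; congr seq_sum; apply/funext => h.
by have [_ ->] := bandit_run_marginal h true tT.
Qed.

Lemma regretE : regret mu T Rw =
  (\sum_(a < k.+1) (mu ord0 - mu a) *
     \sum_(t < T) tree_mean (fun h => lambda (pi h)) t (fun h => (pi h == a)%:R))%:E.
Proof.
pose A t := Rw t @^-1` [set true].
have mA t : measurable (A t) by exact: measurable_funPTI.
have lA t : (\1_(A t) : Om -> R) \in Lfun P 1.
  by apply/Lfun1_integrable; apply: integrable_indic => //; rewrite ltey_eq fin_num_measure.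
rewrite /regret.
have -> : (fun w => mu ord0 * T%:R - \sum_(t < T) (Rw t w)%:R) =
  (cst (mu ord0 * T%:R) \- \sum_(X <- [seq (\1_(A t) : Om -> R) | t <- iota 0 T]) X).
  apply/funext => w /=; congr (_ - _).
  rewrite -(big_mkord xpredT (fun t => (Rw t w)%:R)) big_map fct_sumE /index_iota subn0.
  apply: eq_bigr => t _.
  rewrite indicE /A; case E : (Rw t w); [rewrite mem_set//|rewrite memNset//].
  by rewrite /= E.
rewrite expectationB ?Lfun_cst//; last first.
  by rewrite big_map; apply: rpred_sum => t _; exact: lA.
rewrite expectation_cst expectation_sum; last by move=> X /mapP[t _ ->].
rewrite big_map (eq_bigr (fun t => (prob (A t))%:E)); last first.
  by move=> t _; rewrite expectation_indic// /prob fineK// fin_num_measure.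
have -> : iota 0 T = index_iota 0 T by rewrite /index_iota subn0.
rewrite big_mkord sumEFin -EFinB; congr EFin.
rewrite (eq_bigr (fun t : 'I_T => tree_mean (fun h => lambda (pi h)) t (fun h => mu (pi h))));
  last by move=> t _; rewrite reward_prob.
have -> : mu ord0 * T%:R = \sum_(t < T) mu ord0 by rewrite sumr_const card_ord mulr_natr.
rewrite -sumrB.
under [RHS]eq_bigr do rewrite mulr_sumr.
rewrite exchange_big /=; apply: eq_bigr => t _.
under [RHS]eq_bigr do rewrite -tree_meanZ.
rewrite -tree_mean_sum -[X in X - _](@tree_mean_cst _ (fun h => lambda (pi h)) t).
rewrite -mulN1r -tree_meanZ -tree_meanD; congr tree_mean; apply/funext => h.
(* Only the arm pulled after [h] contributes to the sum of gaps. *)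
rewrite mulN1r (bigD1 (pi h))//= eqxx mulr1 big1 ?addr0// => a /negPf.
by rewrite eq_sym => ->; rewrite mulr0.
Qed.

End RunLaw.

Theorem theorem2 (R : realType) (k : nat)
    (mu lambda : 'I_k.+1 -> R) (g : 'I_k.+1 -> R -> R) (f : nat -> R) :
  corrupt_bandit mu lambda g ->
  (forall a, strictly_monotone01 (g a)) ->
  optimal_arm mu ord0 ->
  {homo f : s t / (s <= t)%N >-> s <= t} ->
  (forall t : nat, (3 <= t)%N -> f t = ln t%:R + 3 * ln (ln t%:R)) ->
  exists (C : R) (T0 : nat),
    forall T : nat, (k.+1 <= T)%N -> (T0 <= T)%N ->
    forall (pi : policy k), kl_ucb_cf g f T pi ->
    forall (d : measure_display) (Om : measurableType d)
      (P : probability Om R) (Fb Rw : nat -> {RV P >-> bool}),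
    bandit_run mu lambda pi T Fb Rw ->
    (regret mu T Rw <=
      \sum_(a < k.+1 | a != ord0)
        ((mu ord0 - mu a) * ln T%:R)%:E / kl (lambda a) (g a (mu ord0))
      + (C * Num.sqrt (ln T%:R))%:E)%E.
Proof.
move=> bandit g_mono opt f_homo fE.
have lambda01 a : 0 <= lambda a <= 1 by case: (bandit a).
have mu01 a : 0 <= mu a <= 1 by case: (bandit a).
(* One constant per arm, chosen before [T], the policy and the probability space; a tied arm gets
   0. *)
have /choice[C HC] : forall a, exists C : R, mu a < mu ord0 -> forall T : nat,
    (k.+1 <= T)%N -> (4 <= T)%N -> forall pi : policy k, kl_ucb_cf g f T pi ->
    \sum_(t < T) tree_mean (fun h => lambda (pi h)) t (fun h => (pi h == a)%:R)
    <= inv_kl (lambda a) (g a (mu ord0)) * ln T%:R + C * Num.sqrt (ln T%:R).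
  move=> a; have [lt|] := boolP (mu a < mu ord0); last by exists 0.
  by have [C HC] := arm_bound bandit g_mono f_homo fE lt; exists C.
exists (\sum_(a < k.+1 | a != ord0) (mu ord0 - mu a) * C a), 4%N.
move=> T kT T4 pi ucb d Om P Fb Rw run.
rewrite (regretE mu01 lambda01 run) (bigD1 ord0)//= subrr mul0r add0r.
rewrite [X in (_ <= X + _)%E](eq_bigr (fun a => ((mu ord0 - mu a) *
    (inv_kl (lambda a) (g a (mu ord0)) * ln T%:R))%:E)); last first.
  (* A tied arm has gap 0; its summand is 0 even if the divergence vanishes, since [0 * +oo = 0]. *)
  move=> a _; have := opt a; rewrite le_eqVlt => /predU1P[->|lt].
    by rewrite subrr !mul0r mul0e.
  have neq := corruption_neq bandit g_mono lt.
  by rewrite -(inv_klEFin (lambda01 a) neq) -EFinM; congr EFin; ring.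
rewrite sumEFin -EFinD lee_fin mulr_suml -big_split /=.
apply: ler_sum => a _; have := opt a; rewrite le_eqVlt => /predU1P[->|lt].
  by rewrite subrr !mul0r addr0.
rewrite -mulrA -mulrDr ler_wpM2l ?subr_ge0 ?opt//.
exact: HC.
Qed.
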